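(* Let $\mathfrak{A}$ be a complex algebra containing the unital subalgebra $\mathfrak{B}$ (the unit $1$ of $\mathfrak{B}$ being the unit of $\mathfrak{A}$), and let $\Phi:\mathfrak{A}\to\mathfrak{B}$ be a conditional expectation. Suppose $\mathfrak{A}_1,\mathfrak{A}_2$ are $\mathfrak{B}$-subalgebras of $\mathfrak{A}$ that are boolean independent over $\mathfrak{B}$, and let $X\in\mathfrak{A}_1$, $Y\in\mathfrak{A}_2$. Then, in the set of multilinear function series over $\mathfrak{B}$, $$\widetilde{B}_{X+Y}=\widetilde{B}_X+\widetilde{B}_Y$$ and $$\widetilde{B}_{(1+X)(1+Y)}=\widetilde{B}_{(1+X)}\,\widetilde{B}_{(1+Y)}.$$
   Context: A conditional expectation $\Phi:\mathfrak{A}\to\mathfrak{B}$ is a linear map with $\Phi(f)=f$ and $\Phi(f a g)=f\Phi(a)g$ for $f,g\in\mathfrak{B}$, $a\in\mathfrak{A}$. Algebras are complex and not necessarily unital. An algebra $\mathfrak{D}$ is called a $\mathfrak{B}$-algebra if either $\mathfrak{B}$ is a subalgebra of $\mathfrak{D}$, or there is an algebra $\widetilde{\mathfrak{D}}$ containing $\mathfrak{B}$ as a subalgebra such that $\widetilde{\mathfrak{D}}=\mathfrak{D}\sqcup\mathfrak{B}$, where $\sqcup$ stands for disjoint union. A $\mathfrak{B}$-subalgebra of $\mathfrak{A}$ is a subalgebra of $\mathfrak{A}$ that is a $\mathfrak{B}$-algebra. Two $\mathfrak{B}$-subalgebras $\mathfrak{A}_1,\mathfrak{A}_2$ of $\mathfrak{A}$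 are boolean independent (with amalgamation) over $\mathfrak{B}$ if $$\Phi(X_1Y_1X_2\cdots)=\Phi(X_1)\Phi(Y_1)\Phi(X_2)\cdots$$ for all $X_1,X_2,\dots\in\mathfrak{A}_1$ and $Y_1,Y_2,\dots\in\mathfrak{A}_2$, for every finite alternating product, starting with a factor from either of the two subalgebras. The $\mathfrak{B}$-valued boolean cumulants $\widetilde{b}^n:\mathfrak{A}^n\times\mathfrak{B}^{n-1}\to\mathfrak{B}$, $n\geq 1$, are the multilinear functions, written $\widetilde{b}^n_{X_1,\dots,X_n}(f_1,\dots,f_{n-1})$, given by the recurrence $$\Phi(X_1f_1X_2\cdots X_{n-1}f_{n-1}X_n)=\sum_{k=1}^n\widetilde{b}^k_{X_1,\dots,X_k}(f_1,\dots,f_{k-1})\,f_k\,\Phi(X_{k+1}f_{k+1}\cdots f_{n-1}X_n)$$ for all $X_1,\dots,X_n\in\mathfrak{A}$ and $f_1,\dots,f_{n-1}\in\mathfrak{B}$, where the $k=n$ term is understood as $\widetilde{b}^n_{X_1,\dots,X_n}(f_1,\dots,f_{n-1})$. Write $\widetilde{b}^n_X=\widetilde{b}^n_{X,\dots,X}$. A multilinear function series over $\mathfrak{B}$ is a sequence $F=(F_0,F_1,\dots)$ with $F_0\in\mathfrak{B}$ and $F_n:\mathfrak{B}^n\to\mathfrak{B}$ multilinear for $n\ge1$. Sum and formal product are $$(F+G)_n(f_1,\dots,f_n)=F_n(f_1,\dots,f_n)+G_n(f_1,\dots,f_n),$$ $$(FG)_n(f_1,\dots,f_n)=\sum_{k=0}^nF_k(f_1,\dots,f_k)\,G_{n-k}(f_{k+1},\dots,f_n).$$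 For $X\in\mathfrak{A}$, $\widetilde{B}_X$ is the multilinear function series of the boolean cumulants of $X$, that is, $(\widetilde{B}_X)_n=\widetilde{b}^{\,n+1}_X$ for $n\ge0$ (so $(\widetilde{B}_X)_0=\widetilde{b}^1_X=\Phi(X)$). *)

(* Defs.v *)
From mathcomp Require Import all_boot all_order all_algebra.
From mathcomp Require Import boolp.

Set Implicit Arguments.
Unset Strict Implicit.
Unset Printing Implicit Defensive.

Import GRing.Theory.
Local Open Scope ring_scope.

(* [B : subAlgType PB] is a unital subalgebra of A, namely {x : A | PB x}, with
   inclusion map [\val], a unital algebra morphism. *)
Definition conditional_expectation (K : fieldType) (A : algType K)
    (PB : {pred A}) (B : subAlgType PB) (Phi : {linear A -> B}) : Prop :=
  (forall f : B, Phi (\val f) = f) /\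
  (forall (f g : B) (a : A), Phi (\val f * a * \val g) = f * Phi a * g).

(* Subalgebras need not contain the unit. *)
Definition subalgebra (K : fieldType) (A : algType K) (D : {pred A}) : Prop :=
  GRing.submod_closed D /\ GRing.mulr_2closed D.

(* The product of A * B for which (d, f) stands for the formal sum of d and f:
   (d + f)(d' + f') = (d d' + d f' + f d') + f f'. *)
Definition amalg_mul (K : fieldType) (A : algType K) (PB : {pred A})
    (B : subAlgType PB) (u v : A * B) : A * B :=
  (u.1 * v.1 + u.1 * \val v.2 + \val u.2 * v.1, u.2 * v.2).

(* A B-algebra D either contains B, or can be completed to an algebra which is
   the disjoint union of D and B.  Two algebras always share 0, so the disjoint
   union is the external direct sum D (+) B, i.e. the pairs (d, f) with d in D
   and f in B; the products d f and f d are those of A.  It is an algebra when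
   it is closed under amalg_mul. *)
Definition B_subalgebra (K : fieldType) (A : algType K) (PB : {pred A})
    (B : subAlgType PB) (D : {pred A}) : Prop :=
  subalgebra D /\
  ((forall f : B, \val f \in D) \/
   (forall u v : A * B, u.1 \in D -> v.1 \in D -> (amalg_mul u v).1 \in D)).

Fixpoint alternating (T : Type) (D1 D2 : {pred T}) (s : seq T) : bool :=
  if s is x :: s' then (x \in D1) && alternating D2 D1 s' else true.

Definition boolean_independent (K : fieldType) (A : algType K)
    (PB : {pred A}) (B : subAlgType PB) (Phi : {linear A -> B})
    (A1 A2 : {pred A}) : Prop :=
  forall s : seq A, alternating A1 A2 s \/ alternating A2 A1 s ->
    Phi (\prod_(x <- s) x) = \prod_(x <- s) Phi x.

(* alt_word [:: X1; ..; Xn] [:: f1; ..; f_(n-1)] = X1 f1 X2 .. f_(n-1) Xn *)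
Fixpoint alt_word (K : fieldType) (A : algType K) (PB : {pred A})
    (B : subAlgType PB) (X : seq A) (f : seq B) : A :=
  match X, f with
  | x :: X', g :: f' => x * \val g * alt_word X' f'
  | x :: _, [::] => x
  | [::], _ => 1
  end.

Section Cumulants.
Context (K : fieldType) (A : algType K) (PB : {pred A}) (B : subAlgType PB).
Context (Phi : {linear A -> B}).
Implicit Types (X : seq A) (f : seq B).

(* The defining recurrence of the boolean cumulants (bcumE below) solved for its
   k = n term, on a list of n elements of A and one of n - 1 elements of B; m
   bounds the recursion depth, and any m >= n > 0 gives the same value. *)
Fixpoint bcum_rec (m : nat) X f : B :=
  if m is m'.+1 then
    Phi (alt_word X f) -
    \sum_(1 <= k < size X)
      bcum_rec m' (take k X) (take k.-1 f) * f`_k.-1 *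
      Phi (alt_word (drop k X) (drop k f))
  else 0.

Definition bcum (n : nat) (X : n.-tuple A) (f : n.-1.-tuple B) : B :=
  bcum_rec n X f.

Lemma bcum_rec_stable m1 m2 X f :
  (0 < size X <= m1)%N -> (size X <= m2)%N ->
  bcum_rec m1 X f = bcum_rec m2 X f.
Proof.
elim: m1 m2 X f => [|m1 IH] [|m2] X f; first by case: X.
- by case: X.
- by case: X.
move=> /andP[X0 Xm1] Xm2 /=; congr (_ - _).
apply: eq_big_nat => k /andP[k0 kX]; congr (_ * _ * _).
apply: IH; rewrite size_takel ?(ltnW kX) ?k0 //=.
  by rewrite -ltnS (leq_trans kX).
by rewrite -ltnS (leq_trans kX).
Qed.

Lemma bcumE n (X : n.-tuple A) (f : n.-1.-tuple B) : (0 < n)%N ->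
  Phi (alt_word X f) =
  \sum_(1 <= k < n)
     bcum_rec k (take k X) (take k.-1 f) * f`_k.-1 *
     Phi (alt_word (drop k X) (drop k f))
  + bcum X f.
Proof.
case: n X f => // n X f _; rewrite /bcum /= size_tuple addrC.
apply: (canRL (subrK _)); congr (_ - _).
apply: eq_big_nat => k /andP[k0 kn]; congr (_ * _ * _).
have sk : size (take k X) = k by rewrite size_takel // size_tuple ltnW.
by apply: bcum_rec_stable; rewrite sk ?k0 ?leqnn // -ltnS.
Qed.

Lemma alt_word_linear X (s1 s2 : seq B) (a : K) (x y : B) :
  (size s1 < size X)%N ->
  alt_word X (s1 ++ (a *: x + y) :: s2) =
  a *: alt_word X (s1 ++ x :: s2) + alt_word X (s1 ++ y :: s2).
Proof.
elim: s1 X => [|g s1 IH] [|z X] //= sX.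
  by rewrite raddfD /= linearZ /= mulrDr mulrDl -scalerAr -scalerAl.
by rewrite IH // mulrDr -scalerAr.
Qed.

Lemma bcum_rec_linear m X (s1 s2 : seq B) (a : K) (x y : B) :
  (size s1 < size X)%N ->
  bcum_rec m X (s1 ++ (a *: x + y) :: s2) =
  a *: bcum_rec m X (s1 ++ x :: s2) + bcum_rec m X (s1 ++ y :: s2).
Proof.
elim: m X s1 s2 => [|m IH] X s1 s2 sX /=; first by rewrite scaler0 addr0.
rewrite alt_word_linear // linearP scalerBr -!addrA; congr (_ + _).
rewrite addrCA; congr (_ + _); rewrite -opprD; congr (- _).
rewrite scaler_sumr -big_split /=; apply: eq_big_nat => -[//|k] /andP[_ kX] /=.
rewrite !take_cat !nth_cat !drop_cat.
case: (ltngtP k (size s1)) => ks.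
- have [k1|k1] := ltnP k.+1 (size s1).
    rewrite alt_word_linear ?size_drop ?ltn_sub2r // linearP.
    by rewrite mulrDr -scalerAr.
  have -> : (k.+1 - size s1)%N = 0%N by apply/eqP; rewrite subn_eq0.
  rewrite !drop0.
  have h z : z :: s2 = [::] ++ z :: s2 by [].
  rewrite (h (_ + _)) (h x) (h y) alt_word_linear ?size_drop ?subn_gt0 //.
  by rewrite linearP mulrDr -scalerAr.
- rewrite [(k.+1 < _)%N]ltnNge (leqW (ltnW ks)) /= subSn ?(ltnW ks) //.
  case E: (k - size s1)%N => [|j] /=.
    by move/eqP: E; rewrite subn_eq0 leqNgt ks.
  rewrite IH; last by rewrite size_takel ?(ltnW kX) // ltnS ltnW.
  by rewrite !mulrDl -!scalerAl.
- rewrite -ks ltnNge leqnSn /= subnn subSnn /= !drop0.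
  by rewrite mulrDr mulrDl -scalerAr -scalerAl.
Qed.

End Cumulants.

Definition tuple_set (T : Type) (n : nat) (t : n.-tuple T) (i : 'I_n) (x : T) :
    n.-tuple T :=
  [tuple if j == i then x else tnth t j | j < n].

Definition multilinear (K : fieldType) (V : lmodType K) (n : nat)
    (F : n.-tuple V -> V) : Prop :=
  forall (t : n.-tuple V) (i : 'I_n) (a : K) (x y : V),
    F (tuple_set t i (a *: x + y)) =
    a *: F (tuple_set t i x) + F (tuple_set t i y).

(* F_0 in B is the value of [mfs_fun F 0] at the empty tuple. *)
Record mfseries (K : fieldType) (B : algType K) := MFSeries {
  mfs_fun :> forall n : nat, n.-tuple B -> B;
  mfs_multilinear : forall n : nat, multilinear (@mfs_fun n)
}.

Lemma tuple_setE (T : Type) n (t : n.-tuple T) i x :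
  tuple_set t i x = take i t ++ x :: drop i.+1 t :> seq T.
Proof.
have sz : size (take i t ++ x :: drop i.+1 t) = n.
  rewrite size_cat /= size_drop size_takel size_tuple ?(ltnW (ltn_ord i)) //.
  by rewrite subnSK ?ltn_ord // subnKC // ltnW.
apply: (@eq_from_nth _ x); first by rewrite size_tuple sz.
move=> j; rewrite size_tuple => jn.
rewrite (nth_mktuple _ _ (Ordinal jn)) nth_cat size_takel; last first.
  by rewrite size_tuple ltnW.
rewrite (tnth_nth x) -val_eqE /=; case: (ltngtP j i) => ji.
- by rewrite nth_take.
- by rewrite -(subnKC ji) addSn -addnS addKn /= nth_drop addSnnS.
- by rewrite ji subnn.
Qed.

Section Series.
Context (K : fieldType) (B : algType K).
Implicit Types F G : mfseries B.

Lemma mfsP F G : (forall n (t : n.-tuple B), F n t = G n t) -> F = G.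
Proof.
case: F G => [F Fl] [G Gl] /= FG.
have {}FG : F = G by apply: functional_extensionality_dep => n; apply: funext.
by rewrite FG in Fl *; congr MFSeries; apply: Prop_irrelevance.
Qed.

Lemma mfs_val F n m (t : n.-tuple B) (u : m.-tuple B) :
  t = u :> seq B -> F n t = F m u.
Proof.
case: t u => [s ps] [r pr] /= sr; subst r.
have nm : n = m by rewrite -(eqP ps) -(eqP pr).
by subst m; congr (F _ _); apply: val_inj.
Qed.

Lemma mfs_linear F (s1 s2 : seq B) (a : K) (x y : B) n m p
    (t : n.-tuple B) (u : m.-tuple B) (v : p.-tuple B) :
  t = s1 ++ (a *: x + y) :: s2 :> seq B ->
  u = s1 ++ x :: s2 :> seq B -> v = s1 ++ y :: s2 :> seq B ->
  F n t = a *: F m u + F p v.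
Proof.
move=> ts us vs.
have i0 : (size s1 < n)%N.
  by rewrite -(size_tuple t) ts size_cat /= addnS ltnS leq_addr.
have E z : tuple_set t (Ordinal i0) z = s1 ++ z :: s2 :> seq B.
  rewrite tuple_setE /= ts take_size_cat // drop_cat ltnNge leqnSn /= subSnn /=.
  by rewrite drop0.
have -> : F n t = F n (tuple_set t (Ordinal i0) (a *: x + y)).
  by apply: mfs_val; rewrite E.
rewrite mfs_multilinear; congr (_ *: _ + _).
  by apply: mfs_val; rewrite E.
by apply: mfs_val; rewrite E.
Qed.

Definition mfs_add_fun F G n (t : n.-tuple B) : B := F n t + G n t.

Definition mfs_mul_fun F G n (t : n.-tuple B) : B :=
  \sum_(k < n.+1) F _ [tuple of take k t] * G _ [tuple of drop k t].

Fact mfs_add_multilinear F G n : multilinear (@mfs_add_fun F G n).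
Proof.
move=> t i a x y; rewrite /mfs_add_fun !mfs_multilinear scalerDr.
by rewrite addrACA.
Qed.

Fact mfs_mul_multilinear F G n : multilinear (@mfs_mul_fun F G n).
Proof.
move=> t i a x y; rewrite /mfs_mul_fun scaler_sumr -big_split /=.
apply: eq_bigr => k _.
have si : size (take i t) = i by rewrite size_takel // size_tuple ltnW.
case: (ltnP i k) => ik.
- have Ed z w :
      G _ [tuple of drop k (tuple_set t i z)] =
      G _ [tuple of drop k (tuple_set t i w)].
    apply: mfs_val; rewrite /= !tuple_setE !drop_cat si ltnNge (ltnW ik) /=.
    by rewrite -(subnKC ik) addSn -addnS addKn.
  have Et z : take k (tuple_set t i z) =
              take i t ++ z :: take (k - i.+1) (drop i.+1 t).
    rewrite tuple_setE take_cat si ltnNge (ltnW ik) /=.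
    by rewrite -{1}(subnKC ik) addSn -addnS addKn.
  rewrite (mfs_linear F (Et _) (Et x) (Et y)) (Ed _ x) (Ed y x).
  by rewrite mulrDl -scalerAl.
- have Et z w :
      F _ [tuple of take k (tuple_set t i z)] =
      F _ [tuple of take k (tuple_set t i w)].
    apply: mfs_val; rewrite /= !tuple_setE !take_cat si.
    move: ik; rewrite leq_eqVlt => /orP[/eqP -> | ->] //.
    by rewrite ltnn subnn.
  have Ed z : drop k (tuple_set t i z) =
              drop k (take i t) ++ z :: drop i.+1 t.
    rewrite tuple_setE drop_cat si.
    move: ik; rewrite leq_eqVlt => /orP[/eqP -> | ->] //.
    by rewrite ltnn subnn (@drop_oversize _ i (take i t)) ?si.
  rewrite (mfs_linear G (Ed _) (Ed x) (Ed y)) (Et _ x) (Et y x).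
  by rewrite mulrDr -scalerAr.
Qed.

Definition mfs_add F G : mfseries B := MFSeries (mfs_add_multilinear F G).
Definition mfs_mul F G : mfseries B := MFSeries (mfs_mul_multilinear F G).

End Series.

Definition bcum_series_fun (K : fieldType) (A : algType K) (PB : {pred A})
    (B : subAlgType PB) (Phi : {linear A -> B}) (X : A)
    (n : nat) (f : n.-tuple B) : B :=
  bcum Phi [tuple of nseq n.+1 X] f.

Fact bcum_series_multilinear (K : fieldType) (A : algType K) (PB : {pred A})
    (B : subAlgType PB) (Phi : {linear A -> B}) (X : A) (n : nat) :
  multilinear (@bcum_series_fun K A PB B Phi X n).
Proof.
move=> t i a x y; rewrite /bcum_series_fun /bcum !tuple_setE.
apply: bcum_rec_linear; rewrite size_tuple size_takel ?ltnS ?(ltnW (ltn_ord i)) //.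
by rewrite size_tuple ltnW.
Qed.

Definition bcum_series (K : fieldType) (A : algType K) (PB : {pred A})
    (B : subAlgType PB) (Phi : {linear A -> B}) (X : A) : mfseries B :=
  MFSeries (bcum_series_multilinear Phi X).

(* Main.v *)
Require Import Defs.
From mathcomp Require Import all_boot all_order all_algebra.
From mathcomp Require Import reals complex.

Import GRing.Theory.
Local Open Scope ring_scope.

(** The recurrence of the boolean cumulants has a closed solution.  With
    Q a = a - Phi a, which annihilates B and commutes with right multiplication
    by B,
      b(X_1, .., X_n)(f_1, .., f_(n-1)) = Phi (X_1 f_1 Q (X_2 f_2 Q (.. X_n))):
    splitting every tail of X_1 f_1 X_2 .. X_n as Phi (tail) + Q (tail) produces
    exactly the terms of the recurrence ([alt_word_expansion],
    [bcum_rec_centered]).  Write c_Z (s) for the element under Phi when all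
    entries are Z ([cword]); then c_Z (f, s) = Z f Q (c_Z (s)).

    Boolean independence says that x Q (y) cannot be seen by Phi, whatever
    elements of A_1, A_2 and B are multiplied on its left, as soon as x and y
    come from different subalgebras ([centered_crossing]).  Call two elements
    equivalent, a ~ b, when Phi does not distinguish u a from u b for any such
    product u ([moment_eq]).  Since Z f Q respects ~, a cumulant is computed by
    following c_Z along its recursion up to ~.

    For the sum, c_(X+Y) (s) ~ c_X (s) + c_Y (s), because c_X (s) stays in A_1,
    c_Y (s) stays in A_2, and the mixed terms X f Q (c_Y (s)) and Y f Q (c_X (s))
    of the recursion vanish ([cword_add]).

    For the product of Z = 1 + X and W = 1 + Y, the invariant is
      c_(Z W) (s) ~ sum_k c_Z (s_1, .., s_k) Phi (c_W (s_(k+1), .., s_n))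
                    + Q (c_W (s))
    ([cword_mul]).  Applying Phi removes the last term and leaves the formal
    product of the two series.  That term drives the recursion: multiplied by
    Z W f it becomes Z c_W (f, s) ~ Z Phi (c_W (f, s)) + Q (c_W (f, s)), which is
    the new k = 0 term and the new remainder, while in front of Q (c_Z (..)) the
    factor W of Z W f acts as 1. *)
Section BooleanConvolution.
Context {K : fieldType} {A : algType K} {PB : {pred A}} {B : subAlgType PB}.
Context {Phi : {linear A -> B}} (hPhi : conditional_expectation Phi).
Implicit Types (a b c d x y z : A) (f g : B) (D : {pred A}).

(** * Boolean cumulants as moments of centered words *)

Lemma cond_exp_val f : Phi (\val f) = f.
Proof. exact: hPhi.1. Qed.

Lemma cond_expMr a g : Phi (a * \val g) = Phi a * g.
Proof. by have := hPhi.2 1 g a; rewrite rmorph1 !mul1r. Qed.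

(** The complementary projection Q of Phi, with kernel B. *)
Definition centered a : A := a - \val (Phi a).

Lemma centeredK a : \val (Phi a) + centered a = a.
Proof. by rewrite addrC subrK. Qed.

Lemma centeredD a b : centered (a + b) = centered a + centered b.
Proof. by rewrite /centered !raddfD /= addrACA. Qed.

Lemma centered_sum (I : Type) (r : seq I) (P : pred I) (F : I -> A) :
  centered (\sum_(i <- r | P i) F i) = \sum_(i <- r | P i) centered (F i).
Proof. by rewrite /centered !raddf_sum -big_split /=. Qed.

Lemma centeredMr a g : centered (a * \val g) = centered a * \val g.
Proof. by rewrite /centered cond_expMr rmorphM /= mulrBl. Qed.

Lemma centered_val f : centered (\val f) = 0.
Proof. by rewrite /centered cond_exp_val subrr. Qed.

Lemma cond_exp_centered a : Phi (centered a) = 0.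
Proof. by rewrite raddfB /= cond_exp_val subrr. Qed.

Lemma centered_idem a : centered (centered a) = centered a.
Proof. by rewrite [LHS]/centered cond_exp_centered raddf0 subr0. Qed.

(** X_1 g_1 Q (X_2 g_2 Q (.. X_n)); its argument conventions follow [alt_word]. *)
Fixpoint centered_word (X : seq A) (s : seq B) : A :=
  match X, s with
  | x :: X', g :: s' => x * \val g * centered (centered_word X' s')
  | x :: _, [::] => x
  | [::], _ => 1
  end.

(** The recurrence of the boolean cumulants before Phi is applied.  Writing the
    tail X_2 g_2 .. X_n as Phi (tail) + Q (tail) in X_1 g_1 (tail), the first
    part is the k = 1 term; expanding the tail inductively under Q, which is
    right B-linear, gives the others. *)
Lemma alt_word_expansion X (s : seq B) : size X = (size s).+1 ->
  alt_word X s =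
  \sum_(1 <= k < size X) centered_word (take k X) (take k.-1 s) *
     \val (s`_k.-1 * Phi (alt_word (drop k X) (drop k s)))
  + centered_word X s.
Proof.
elim: X s => [//|x X IH] [|g s] /= [sX].
  by rewrite sX big_geq // add0r.
rewrite -{1}(centeredK (alt_word X s)) mulrDr big_ltn ?sX //= ?take0 ?drop0 -addrA.
congr (_ + _); first by rewrite rmorphM mulrA.
rewrite big_add1 /= -sX {1}IH // centeredD mulrDr centered_sum mulr_sumr.
congr (_ + _); apply: eq_big_nat => -[//|k] _ /=.
by rewrite centeredMr mulrA.
Qed.

(** The recurrence determines the cumulants, and by [alt_word_expansion] the
    moments of centered words satisfy it. *)
Lemma bcum_rec_centered m X (s : seq B) : size X = (size s).+1 ->
  (size X <= m)%N -> bcum_rec Phi m X s = Phi (centered_word X s).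
Proof.
elim: m X s => [|m IH] X s sX Xm /=; first by rewrite sX in Xm.
rewrite {1}alt_word_expansion // raddfD raddf_sum /= addrAC -sumrB.
rewrite big_nat big1 ?add0r // => k /andP[k0 kX].
rewrite IH; last by rewrite size_takel ?(ltnW kX) // -ltnS (leq_trans kX).
  by rewrite cond_expMr mulrA subrr.
by rewrite !size_takel ?prednK ?(ltnW kX) // -ltnS prednK // -sX ltnW.
Qed.

Definition cword z (s : seq B) : A := centered_word (nseq (size s).+1 z) s.

Lemma cword_cons z g s : cword z (g :: s) = z * \val g * centered (cword z s).
Proof. by []. Qed.

Lemma bcum_seriesE z n (t : n.-tuple B) : bcum_series Phi z n t = Phi (cword z t).
Proof.
transitivity (bcum_rec Phi n.+1 (nseq n.+1 z) t) => //.
by rewrite bcum_rec_centered ?size_nseq ?size_tuple // /cword size_tuple.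
Qed.

(** * Subalgebras closed under multiplication by B *)

(** Membership in B + D, which contains 1 + z for z in D. *)
Definition unitization D a := exists f : B, a - \val f \in D.

Section Subalgebra.
Context {D : {pred A}} (hD : B_subalgebra B D).

Lemma B_subalgebraM a b : a \in D -> b \in D -> a * b \in D.
Proof. exact: hD.1.2. Qed.

Lemma B_subalgebraD a b : a \in D -> b \in D -> a + b \in D.
Proof. by move=> aD bD; rewrite -[a]scale1r; apply: hD.1.1.2. Qed.

Lemma B_subalgebraB a b : a \in D -> b \in D -> a - b \in D.
Proof. by move=> aD bD; rewrite addrC -scaleN1r; apply: hD.1.1.2. Qed.

(** If D contains B, this is a product in D; otherwise it is the D-component of
    the product of (0, f) and (a, 0) in the direct sum of D and B. *)
Lemma B_subalgebraMl f a : a \in D -> \val f * a \in D.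
Proof.
case: hD.2 => [BD|mulD] aD; first exact: B_subalgebraM.
have := mulD (0, f) (a, 0); rewrite /amalg_mul /= raddf0 !mul0r !add0r.
by apply=> //; apply: hD.1.1.1.
Qed.

Lemma B_subalgebraMr f a : a \in D -> a * \val f \in D.
Proof.
case: hD.2 => [BD|mulD] aD; first exact: B_subalgebraM.
have := mulD (a, 0) (0, f); rewrite /amalg_mul /= raddf0 mulr0 mul0r add0r addr0.
by apply=> //; apply: hD.1.1.1.
Qed.

Lemma B_subalgebra_centered x f a : x \in D -> a \in D ->
  x * \val f * centered a \in D.
Proof.
move=> xD aD; rewrite mulrBr -mulrA -[x * \val f * _]mulrA -rmorphM.
by rewrite B_subalgebraB // ?B_subalgebraMr // B_subalgebraM // B_subalgebraMl.
Qed.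

Lemma cword_in_subalgebra z s : z \in D -> cword z s \in D.
Proof. by move=> zD; elim: s => //= g s IH; apply: B_subalgebra_centered. Qed.

(** Writing the inner word as h + d with d in D, centering removes h, so that
    (1 + z) g Q (d) = (g d + z g Q (d)) - g Phi (d) is again in D + B. *)
Lemma cword_in_unitization z s : z \in D -> unitization D (cword (1 + z) s).
Proof.
move=> zD; elim: s => [|g s [f fD]].
  by exists 1; rewrite rmorph1 addrAC subrr add0r.
rewrite cword_cons; set w := cword _ s in fD *.
have -> : centered w = centered (w - \val f).
  by rewrite centeredD -raddfN centered_val addr0.
exists (- (g * Phi (w - \val f))).
rewrite raddfN opprK mulrDl mul1r mulrDl mulrBr -rmorphM addrAC subrK.
by rewrite B_subalgebraD ?B_subalgebraMl // B_subalgebra_centered.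
Qed.

End Subalgebra.

(** * Moment equivalence under boolean independence *)

Section Independence.
Context {A1 A2 : {pred A}}.
Context (hA1 : B_subalgebra B A1) (hA2 : B_subalgebra B A2).
Context (hind : boolean_independent Phi A1 A2).

Lemma prod_rcons (R : pzSemiRingType) (T : Type) (F : T -> R) s t :
  \prod_(u <- rcons s t) F u = \prod_(u <- s) F u * F t.
Proof. by rewrite -cats1 big_cat big_seq1. Qed.

Definition letter z := [\/ z \in A1, z \in A2 | exists f, z = \val f].

Definition letters (s : seq A) := forall z, z \in s -> letter z.

(** Products on the left only: the words to be compared are built from right to
    left, by multiplying on the left and centering. *)
Definition moment_eq a b := forall s, letters s ->
  Phi (\prod_(z <- s) z * a) = Phi (\prod_(z <- s) z * b).

(** Boolean independence is symmetric in the two subalgebras; arguments that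
    exchange their roles run over both orders. *)
Definition independent_pair D D' := (D = A1 /\ D' = A2) \/ (D = A2 /\ D' = A1).

Lemma independent_pair_sym D D' : independent_pair D D' -> independent_pair D' D.
Proof. by case=> -[-> ->]; [right|left]. Qed.

Lemma independent_pair_alternating D D' s : independent_pair D D' -> alternating D D' s ->
  Phi (\prod_(x <- s) x) = \prod_(x <- s) Phi x.
Proof. by move=> hD sD; apply: hind; case: hD sD => -[-> ->]; [left|right]. Qed.

Lemma independent_pair_sub D D' : independent_pair D D' -> B_subalgebra B D.
Proof. by case=> -[-> _]. Qed.

Lemma independent_pair_letter D D' z : independent_pair D D' -> letter z ->
  [\/ z \in D, z \in D' | exists f, z = \val f].
Proof.
by case=> -[-> ->] // [zD|zD|zB]; [apply: Or32|apply: Or31|apply: Or33].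
Qed.

(** Boolean independence gives Phi (p y) = Phi (p) Phi (y), that is
    Phi (p Q (y)) = 0, for an alternating word p that stays alternating with y at
    its end.  An arbitrary product on the left of p is absorbed letter by letter
    into its head x: a letter of B or of the algebra of x is multiplied into x, a
    letter of the other algebra becomes the new head.  The end of p, where y is
    attached, does not change. *)
Lemma alternating_centered_vanish s D D' x p y :
  independent_pair D D' -> letters s ->
  alternating D D' (x :: p) -> alternating D D' (rcons (x :: p) y) ->
  Phi (\prod_(z <- s) z * \prod_(z <- x :: p) z * centered y) = 0.
Proof.
elim/last_ind: s D D' x p => [|s z IH] D D' x p hD hs pD pyD.
  rewrite big_nil mul1r mulrBr -prod_rcons raddfB /= cond_expMr.
  by rewrite !(independent_pair_alternating _ _ _ hD) // -rcons_cons prod_rcons subrr.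
have hs' : letters s by move=> t ts; apply: hs; rewrite mem_rcons inE ts orbT.
have := hs z; rewrite mem_rcons mem_head => /(_ isT).
have {pD pyD} [/andP[xD pD] /andP[_ pyD]] := (pD, pyD).
rewrite prod_rcons -[_ * z * _]mulrA.
have absorb : z * x \in D ->
    Phi (\prod_(t <- s) t * (z * \prod_(t <- x :: p) t) * centered y) = 0.
  move=> zxD.
  have -> : z * \prod_(t <- x :: p) t = \prod_(t <- z * x :: p) t.
    by rewrite !big_cons mulrA.
  by apply: (IH D D') => //=; rewrite zxD.
case/(independent_pair_letter _ _ _ hD) => [zD|zD'|[f zf]].
- by apply: absorb; apply: (B_subalgebraM (independent_pair_sub _ _ hD)).
- have -> : z * \prod_(t <- x :: p) t = \prod_(t <- z :: x :: p) t.
    by rewrite [RHS]big_cons.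
  by apply: (IH D' D) (independent_pair_sym _ _ hD) hs' _ _ => /=; rewrite zD' xD.
- by apply: absorb; rewrite zf; apply: (B_subalgebraMl (independent_pair_sub _ _ hD)).
Qed.

Lemma moment_eq_refl a : moment_eq a a.
Proof. by []. Qed.

Lemma moment_eq_trans b a c : moment_eq a b -> moment_eq b c -> moment_eq a c.
Proof. by move=> ab bc s hs; rewrite ab // bc. Qed.

Lemma moment_eqD a b c d :
  moment_eq a b -> moment_eq c d -> moment_eq (a + c) (b + d).
Proof. by move=> ab cd s hs; rewrite !mulrDr !raddfD /= ab // cd. Qed.

Lemma moment_eq_sum (I : Type) (r : seq I) (F G : I -> A) :
  (forall i, moment_eq (F i) (G i)) ->
  moment_eq (\sum_(i <- r) F i) (\sum_(i <- r) G i).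
Proof.
move=> FG; elim: r => [|i r IH]; first by rewrite !big_nil.
by rewrite !big_cons; apply: moment_eqD.
Qed.

Lemma moment_eqMr a b g :
  moment_eq a b -> moment_eq (a * \val g) (b * \val g).
Proof. by move=> ab s hs; rewrite !mulrA !cond_expMr ab. Qed.

Lemma moment_eq_cond_exp a b : moment_eq a b -> Phi a = Phi b.
Proof. by move=> /(_ [::]); rewrite big_nil !mul1r; apply. Qed.

Lemma moment_eqMl z a b : letter z -> moment_eq a b -> moment_eq (z * a) (z * b).
Proof.
move=> hz ab s hs; rewrite !mulrA -prod_rcons; apply: ab => t.
by rewrite mem_rcons inE => /orP[/eqP->|/hs].
Qed.

Lemma letter_val f : letter (\val f).
Proof. by apply: Or33; exists f. Qed.

Lemma moment_eq_centered a b :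
  moment_eq a b -> moment_eq (centered a) (centered b).
Proof.
move=> ab; rewrite /centered (moment_eq_cond_exp _ _ ab).
exact: moment_eqD.
Qed.

Lemma centered_crossing D D' x a : independent_pair D D' ->
  x \in D -> unitization D' a -> moment_eq (x * centered a) 0.
Proof.
move=> hD xD [f aD] s hs; rewrite mulr0 raddf0 mulrA.
rewrite -(subrK (\val f) a) centeredD centered_val addr0.
have := alternating_centered_vanish s D D' x [::] (a - \val f) hD hs.
by rewrite big_seq1; apply; rewrite /= ?xD ?aD.
Qed.

Lemma independent_pair_in_letter D D' x : independent_pair D D' -> x \in D -> letter x.
Proof. by case=> -[-> _]; [apply: Or31|apply: Or32]. Qed.

(** The component b of the inner word in the algebra opposite to x is lost when
    the recursion of centered words multiplies by x. *)
Lemma moment_eq_crossing D D' x g w a b : independent_pair D D' -> x \in D ->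
  unitization D' b -> moment_eq w (a + b) ->
  moment_eq (x * \val g * centered w) (x * \val g * centered a).
Proof.
move=> hD xD bD' wab.
have xgD : x * \val g \in D by apply: (B_subalgebraMr (independent_pair_sub _ _ hD)).
apply: (moment_eq_trans (x * \val g * centered (a + b))).
  apply: moment_eqMl; first exact: independent_pair_in_letter hD xgD.
  exact: moment_eq_centered.
rewrite centeredD mulrDr -[in X in moment_eq _ X](addr0 (x * _ * _)).
exact: moment_eqD (moment_eq_refl _) (centered_crossing _ _ _ _ hD xgD bD').
Qed.

Lemma mem_unitization D a : a \in D -> unitization D a.
Proof. by move=> aD; exists 0; rewrite raddf0 subr0. Qed.

(** * Centered words of x + y and of (1 + x) (1 + y) *)
Section Pair.
Context {x y : A} (hx : x \in A1) (hy : y \in A2).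

Let pair12 : independent_pair A1 A2. Proof. by left. Qed.
Let pair21 : independent_pair A2 A1. Proof. by right. Qed.

(** Without its mixed terms, the recursion for x + y is that for x plus that
    for y. *)
Lemma cword_add s : moment_eq (cword (x + y) s) (cword x s + cword y s).
Proof.
elim: s => [|g s IH]; first exact: moment_eq_refl.
rewrite !cword_cons !mulrDl; apply: moment_eqD.
  apply: (moment_eq_crossing A1 A2 x g _ _ (cword y s)) => //.
  by apply: mem_unitization; apply: (cword_in_subalgebra hA2).
apply: (moment_eq_crossing A2 A1 y g _ _ (cword x s)) => //.
  by apply: mem_unitization; apply: (cword_in_subalgebra hA1).
by rewrite [cword y s + _]addrC.
Qed.

Lemma moment_eqMl1 a b : moment_eq a b -> moment_eq ((1 + x) * a) ((1 + x) * b).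
Proof.
move=> ab; rewrite !mulrDl !mul1r; apply: moment_eqD => //.
by apply: moment_eqMl => //; apply: Or31.
Qed.

(** From a = Phi (a) + Q (a): in (1 + x) Q (a) the term x Q (a) crosses from one
    algebra to the other. *)
Lemma moment_eq_mul1 a : unitization A2 a ->
  moment_eq ((1 + x) * a) ((1 + x) * \val (Phi a) + centered a).
Proof.
move=> aD; rewrite -{1}(centeredK a) mulrDr.
apply: moment_eqD; first exact: moment_eq_refl.
rewrite mulrDl mul1r -[X in moment_eq _ X]addr0.
by apply: moment_eqD => //; exact: (centered_crossing A1 A2 _ _ pair12 hx aD).
Qed.

(** With the induction hypothesis under Q, the new outermost factor
    (1 + x) (1 + y) g meets two kinds of terms.  In front of centered words in
    1 + x the factor 1 + y acts as 1, which lengthens the first word of each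
    summand by g.  In front of the remainder, (1 + y) g Q (..) is the longer word
    in 1 + y, and [moment_eq_mul1] splits off the k = 0 summand. *)
Lemma cword_mul s :
  moment_eq (cword ((1 + x) * (1 + y)) s)
    (\sum_(k < (size s).+1)
        cword (1 + x) (take k s) * \val (Phi (cword (1 + y) (drop k s)))
     + centered (cword (1 + y) s)).
Proof.
elim: s => [|g s IH].
  rewrite big_ord1; apply: moment_eq_mul1.
  exact: (cword_in_unitization hA2 y [::]).
have IHc := moment_eq_centered _ _ IH.
rewrite centeredD centered_idem centered_sum in IHc.
set w := (1 + x) * (1 + y) in IH IHc *.
have gl : letter (\val g) by apply: letter_val.
have yl : letter y by apply: Or32.
have crossx k : moment_eq ((1 + y) * \val g * centered (cword (1 + x) (take k s)))
    (\val g * centered (cword (1 + x) (take k s))).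
  rewrite mulrDl mul1r mulrDl -[X in moment_eq _ X]addr0; apply: moment_eqD => //.
  apply: (centered_crossing A2 A1 _ _ pair21); first exact: B_subalgebraMr.
  exact: (cword_in_unitization hA1).
rewrite cword_cons /w -mulrA -mulrA.
apply: (moment_eq_trans ((1 + x) * (\sum_(k < (size s).+1)
    \val g * centered (cword (1 + x) (take k s)) *
      \val (Phi (cword (1 + y) (drop k s)))
    + cword (1 + y) (g :: s)))).
  apply: moment_eqMl1.
  apply: (moment_eq_trans ((1 + y) * (\val g * (\sum_(k < (size s).+1)
      centered (cword (1 + x) (take k s) * \val (Phi (cword (1 + y) (drop k s))))
      + centered (cword (1 + y) s))))).
    rewrite mulrDl mul1r [X in moment_eq _ X]mulrDl mul1r.
    by apply: moment_eqD; do ?apply: moment_eqMl.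
  rewrite mulrA mulrDr cword_cons mulr_sumr.
  apply: moment_eqD => //; apply: moment_eq_sum => k.
  by rewrite centeredMr mulrA; apply: moment_eqMr.
rewrite mulrDr mulr_sumr [in X in moment_eq _ X]big_ord_recl drop0 [X in moment_eq _ X]addrAC.
rewrite [X in moment_eq X _]addrC; apply: moment_eqD.
  by apply: moment_eq_mul1; apply: cword_in_unitization.
by apply: moment_eq_sum => k; rewrite /= cword_cons !mulrA.
Qed.

End Pair.
End Independence.
End BooleanConvolution.

Theorem corollary4p6 (R : realType) (A : algType R[i])
    (PB : {pred A}) (B : subAlgType PB) (Phi : {linear A -> B})
    (hPhi : conditional_expectation Phi)
    (A1 A2 : {pred A})
    (hA1 : B_subalgebra B A1) (hA2 : B_subalgebra B A2)
    (hind : boolean_independent Phi A1 A2)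
    (X Y : A) (hX : X \in A1) (hY : Y \in A2) :
  bcum_series Phi (X + Y) =
    mfs_add (bcum_series Phi X) (bcum_series Phi Y) /\
  bcum_series Phi ((1 + X) * (1 + Y)) =
    mfs_mul (bcum_series Phi (1 + X)) (bcum_series Phi (1 + Y)).
Proof.
split; apply: mfsP => n t; rewrite (bcum_seriesE hPhi).
  rewrite (moment_eq_cond_exp _ _ (cword_add hPhi hA1 hA2 hind hX hY t)) raddfD.
  by rewrite /= /mfs_add_fun !(bcum_seriesE hPhi).
rewrite (moment_eq_cond_exp _ _ (cword_mul hPhi hA1 hA2 hind hX hY t)) raddfD.
rewrite /= (cond_exp_centered hPhi) addr0 raddf_sum size_tuple.
by apply: eq_bigr => k _; rewrite !(bcum_seriesE hPhi) /= (cond_expMr hPhi).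
Qed.
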